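(* Let $q$ be an odd prime power and $\varepsilon=(-1)^{(q-1)/2}$ (so $q\equiv\varepsilon\pmod 4$ and $\varepsilon=\left(\frac{-1}{q}\right)$). For every $k\ge 1$ we have $D_k(2)=2$, $D_k(-2)=(-1)^k\cdot 2$, and, viewing $D_k$ as a map ${\mathbb F}_q\to{\mathbb F}_q$: (i) $D_k(\mathcal A_2^{++})\subset \mathcal A_2^{++}\sqcup\{2,-2\varepsilon\}$ and $D_k(\mathcal A_2^{-+})\subset \mathcal A_2^{-+}\sqcup\{2,2\varepsilon\}$. (ii) If $k$ is odd then $D_k(\mathcal A_2^{\varepsilon,-})\subset \mathcal A_2^{\varepsilon,-}\sqcup\{-2\}$ and $D_k(\mathcal A_2^{-\varepsilon,-})\subset\mathcal A_2^{-\varepsilon,-}$. (iii) If $k$ is even then $D_k(\mathcal A_2^{--})\subset \mathcal A_2^{++}\sqcup\{2,-2\varepsilon\}$ and $D_k(\mathcal A_2^{+-})\subset\mathcal A_2^{-+}\sqcup\{2,2\varepsilon\}$. (iv) If $(q-1)/2$ divides $k$, then $D_k({\mathbb F}_q)\subset \mathcal A_2^{+-}\sqcup\mathcal A_2^{-+}\sqcup\{2,-2\}$; if in addition $k$ is even then $D_k({\mathbb F}_q)\subset\mathcal A_2^{-+}\sqcup\{2,-2\}$. (v) If $(q+1)/2$ divides $k$, then $D_k({\mathbb F}_q)\subset \mathcal A_2^{++}\sqcup\mathcal A_2^{--}\sqcup\{2,-2\}$; if in addition $k$ is even then $D_k({\mathbb F}_q)\subset\mathcal A_2^{++}\sqcup\{2,-2\}$.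 (vi) If $\mathcal A_2^{\varepsilon_1,\varepsilon_2}$ is nonempty, then $D_k$ permutes $\mathcal A_2^{\varepsilon_1,\varepsilon_2}$ if and only if $\gcd(k,d^{\varepsilon_1,\varepsilon_2})=1$, where $d^{++}=(q-1)/2$, $d^{+-}=q+1$, $d^{-+}=(q+1)/2$, $d^{--}=q-1$.
   Context: The Dickson polynomials of the first kind $D_k(x)\in\mathbb Z[x]$ are defined by $D_0=2$, $D_1=x$, $D_{k+2}=xD_{k+1}-D_k$; equivalently $D_k(u+1/u)=u^k+u^{-k}$ for an indeterminate $u$. They are regarded as functions on ${\mathbb F}_q$ by reducing coefficients. For $q$ odd and $a\in{\mathbb F}_q$, $\left(\frac{a}{q}\right)$ is $1$ if $a$ is a nonzero square, $-1$ if $a$ is a nonsquare, $0$ if $a=0$. For $\varepsilon_1,\varepsilon_2\in\{1,-1\}$ (written $+,-$) and $\lambda\in{\mathbb F}_q^\times$, $\mathcal A_\lambda^{\varepsilon_1,\varepsilon_2}=\{u\in{\mathbb F}_q: \left(\frac{u-\lambda}{q}\right)=\varepsilon_1,\ \left(\frac{u+\lambda}{q}\right)=\varepsilon_2\}$. *)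

(* Defs.v *)
From HB Require Import structures.
From mathcomp Require Import all_boot all_order all_algebra all_fingroup all_field.
Set Implicit Arguments. Unset Strict Implicit. Unset Printing Implicit Defensive.
Import Order.TTheory GRing.Theory Num.Theory.
Local Open Scope ring_scope.

(* Dickson polynomials of the first kind over a ring R:
   D_0 = 2, D_1 = X, D_{k+2} = X D_{k+1} - D_k.
   (Over F_q this is exactly the reduction mod p of the integer polynomial.) *)
Fixpoint dickson_pair (R : nzRingType) (k : nat) : {poly R} * {poly R} :=
  match k with
  | 0%N => (2%:P, 'X)
  | k'.+1 => let: (a, b) := dickson_pair R k' in (b, 'X * b - a)
  end.

Definition dickson (R : nzRingType) (k : nat) : {poly R} := (dickson_pair R k).1.

Definition dfun (F : finFieldType) (k : nat) (u : F) : F := (dickson F k).[u].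

Definition legendre (F : finFieldType) (a : F) : int :=
  if a == 0 then 0 else if [exists b : F, b ^+ 2 == a] then 1 else -1.

Definition Aset (F : finFieldType) (lam : F) (e1 e2 : int) : {set F} :=
  [set u | (legendre (u - lam) == e1) && (legendre (u + lam) == e2)].

Definition epsq (F : finFieldType) : int := (-1) ^+ ((#|F|).-1./2).

Definition dsign (q : nat) (e1 e2 : int) : nat :=
  if e1 == 1 then (if e2 == 1 then q.-1./2 else q.+1)
  else (if e2 == 1 then q.+1./2 else q.-1).

(* Main.v *)
Require Import Defs.
From HB Require Import structures.
From mathcomp Require Import all_boot all_order all_algebra all_fingroup all_field.
From mathcomp Require Import all_solvable ring zify.
Import Order.TTheory GRing.Theory Num.Theory.
Local Open Scope ring_scope.

(* Work in an algebraic closure of F_q and write u = y + 1/y, so that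
   D_k(u) = y^k + y^-k.  As u is fixed by the q-Frobenius, y^q = y or
   y^q = 1/y; since u + 2s = (y + s)^2 / y for s = 1, -1, Euler's criterion then
   gives, with eta = e1 e2,
     u \in A_2^{e1,e2}  <->  y^((q - eta)/2) = e2 and y^2 != 1.
   Parts (i)-(v) follow by tracking this condition under y -> y^k.  In (vi), the
   class of y lies in the group of n-th roots of unity for n = d^{e1,e2}, on
   which y -> y^k is injective if gcd(k, n) = 1.  Conversely, a root of unity
   z != 1 whose order divides both k and (q - eta)/2 gives another element
   yz + 1/(yz) of the class with the same image as y + 1/y; the only
   common divisor 2 not arising this way, for e2 = -1, is excluded because D_k
   with k even leaves the classes with e2 = -1. *)

(** * Dickson polynomials at y + 1/y *)

Lemma dicksonSS (R : nzRingType) n :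
  dickson R n.+2 = 'X * dickson R n.+1 - dickson R n.
Proof. by rewrite /dickson /=; case: (dickson_pair R n). Qed.

Lemma horner_dickson (K : fieldType) (y : K) n :
  y != 0 -> (dickson K n).[y + y^-1] = y ^+ n + y^-1 ^+ n.
Proof.
move=> y0; have yV : y * y^-1 = 1 by rewrite mulfV.
suff: (dickson K n).[y + y^-1] = y ^+ n + y^-1 ^+ n /\
      (dickson K n.+1).[y + y^-1] = y ^+ n.+1 + y^-1 ^+ n.+1 by case.
elim: n => [|n [IH1 IH2]]; first by rewrite /dickson /= !hornerE.
split=> //; rewrite dicksonSS !hornerE IH1 IH2 !exprS.
by ring: yV.
Qed.

Lemma map_dickson (R S : nzRingType) (f : {rmorphism R -> S}) n :
  map_poly f (dickson R n) = dickson S n.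
Proof.
suff: map_poly f (dickson R n) = dickson S n /\
      map_poly f (dickson R n.+1) = dickson S n.+1 by case.
elim: n => [|n [IH1 IH2]].
  by rewrite /dickson /= map_polyC map_polyX /= (rmorph_nat f).
by split=> //; rewrite !dicksonSS rmorphB rmorphM /= map_polyX IH1 IH2.
Qed.

Lemma rmorph_dfun (F : finFieldType) (K : fieldType) (f : {rmorphism F -> K})
    (k : nat) (u : F) (y : K) :
  y != 0 -> f u = y + y^-1 -> f (dfun k u) = y ^+ k + y^-1 ^+ k.
Proof.
by move=> y0 fu; rewrite /dfun -horner_map map_dickson fu horner_dickson.
Qed.

(** The difference of the two sides, multiplied by [y], factors as (y - z)(y - 1/z). Thus [u]
    determines its parameter [y] up to inversion. *)
Lemma addfV_eq (K : fieldType) (y z : K) : y != 0 -> z != 0 ->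
  y + y^-1 = z + z^-1 -> y = z \/ y = z^-1.
Proof.
move=> y0 z0 eq_yz; have: (y - z) * (y - z^-1) == 0.
  have -> : (y - z) * (y - z^-1) = y * (y + y^-1 - (z + z^-1)).
    by field; rewrite y0 z0.
  by rewrite eq_yz subrr mulr0.
by rewrite mulf_eq0 !subr_eq0 => /orP[] /eqP; [left | right].
Qed.

(** Bezout with natural exponents only, so [x] need not be known to be a unit. *)
Lemma coprime_expr_eq1 (R : unitRingType) (x : R) (m n : nat) :
  (0 < m)%N -> coprime m n -> x ^+ m = 1 -> x ^+ n = 1 -> x = 1.
Proof.
move=> m0 /eqP mn xm xn; case: (egcdnP n m0) => km kn; rewrite mn => e _.
have := congr1 (fun i => x ^+ i) e.
by rewrite /= mulnC exprM xm expr1n addn1 exprSr mulnC exprM xn expr1n mul1r.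
Qed.

(** * Frobenius and roots in an algebraically closed extension *)

Section ClosedExtension.

Variables (F : finFieldType) (K : closedFieldType) (f : {rmorphism F -> K}).
Local Notation q := #|F|.

Lemma exprD_card (x y : K) : (x + y) ^+ q = x ^+ q + y ^+ q.
Proof.
apply: exprDn_pchar; have [p p_pr pF] := finPcharP F.
rewrite (eq_pnat _ (fmorph_pchar f)) (eq_pnat _ (pcharf_eq pF)) -cardsT.
exact: pprimeChar_pgroup pF.
Qed.

(** Over [F], X^q - X is the product of all X - a, so its roots in [K] come from [F]. *)
Lemma fixed_in_base (x : K) : x ^+ q = x -> exists a, x = f a.
Proof.
move=> xq; have: root (map_poly f ('X^q - 'X)) x.
  by rewrite rmorphB /= map_polyXn map_polyX rootE !hornerE xq subrr.
rewrite finField_genPoly rmorph_prod /= /root horner_prod prodf_seq_eq0.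
case/hasP=> a _; rewrite /= map_polyXsubC hornerXsubC subr_eq0 => /eqP ->.
by exists a.
Qed.

Lemma fixed_rmorph (u : F) : f u ^+ q = f u.
Proof. by rewrite -rmorphXn expf_card. Qed.

Lemma addfV_root (u : F) : exists2 y : K, y != 0 & f u = y + y^-1.
Proof.
(* Coefficients of the monic equation Y^2 = f(u) Y - 1. *)
pose P i : K := if i == 0%N then -1 else f u.
have [y] := solve_monicpoly P (isT : (0 < 2)%N).
rewrite big_ord_recl big_ord1 /P /= expr0 expr1 mulr1 => y2.
have y0 : y != 0.
  by apply/eqP => y0; move/eqP: y2; rewrite y0 expr0n mulr0 addr0
     eq_sym oppr_eq0 oner_eq0.
exists y => //; apply: (mulIf y0); rewrite mulrDl mulVf // -expr2 y2.
by rewrite addrAC addNr add0r.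
Qed.

(** Take a root of 1 + Y + ... + Y^(p-1). If it were 1, then p = 0 in [K], hence m = 0. *)
Lemma unity_root_pdiv (p m : nat) : prime p ->
  m%:R != 0 :> K -> (p %| m)%N -> exists2 z : K, z ^+ p = 1 & z != 1.
Proof.
move=> p_pr m0 p_m; have p_gt1 := prime_gt1 p_pr; have p1 : (0 < p.-1)%N by lia.
have [z zp] := solve_monicpoly (fun=> -1 : K) p1.
have sz : \sum_(i < p) z ^+ i = 0.
  rewrite -(ltn_predK p_gt1) big_ord_recr /= zp -big_split big1 //= => i _.
  by rewrite mulN1r addrN.
exists z; first by apply/eqP; rewrite -subr_eq0 subrX1 sz mulr0.
apply: contraNneq m0 => z1; move: sz; rewrite z1 (eq_bigr (fun=> 1)) => [|i _];
  last by rewrite expr1n.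
rewrite sumr_const card_ord => p0.
by rewrite -(divnK p_m) natrM p0 mulr0.
Qed.

(** * Euler's criterion *)

Hypothesis q_odd : odd q.

Lemma natf_card : q%:R = 0 :> F.
Proof. by rewrite -FinRing.zmodXgE -cardsT expg_cardG ?inE. Qed.

Lemma two_neq0 (L : nzRingType) (g : {rmorphism F -> L}) : 2 != 0 :> L.
Proof.
apply/eqP => two0; have := rmorph1 g; have := congr1 g natf_card.
rewrite rmorph_nat rmorph0 -(odd_double_half q) q_odd -muln2 natrD natrM two0.
by rewrite mulr0 addr0 => /eqP; rewrite oner_eq0.
Qed.

Lemma signr_field_inj (L : fieldType) (g : {rmorphism F -> L}) (b c : bool) :
  (-1) ^+ b = (-1) ^+ c :> L -> b = c.
Proof.
have neq1 : 1 != -1 :> L by rewrite -subr_eq0 opprK (two_neq0 _ g).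
by case: b c => [] [] //= /eqP;
  rewrite expr0 expr1 ?(negPf neq1) // eq_sym (negPf neq1).
Qed.

Lemma half_gt0 : (0 < q.-1./2)%N.
Proof. by move: q_odd (finNzRing_gt1 F); move: q => n; lia.
Qed.

Lemma half_double : (q.-1./2 * 2)%N.+1 = q.
Proof. by move: q_odd (finNzRing_gt1 F); move: q => n; lia.
Qed.

Lemma expr_half_double (L : fieldType) (x : L) :
  x ^+ q = x -> x != 0 -> x ^+ (2 * q.-1./2) = 1.
Proof.
move=> xq x0; apply: (mulfI x0).
by rewrite -exprS mulnC half_double xq mulr1.
Qed.

Lemma legendre_expr (a : F) : (legendre a)%:~R = a ^+ q.-1./2.
Proof.
rewrite /legendre; have [->|a0] := eqVneq a 0.
  by rewrite expr0n gtn_eqF ?half_gt0.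
case: existsP => [[c /eqP c2]|nsq].
  rewrite -c2 -exprM expr_half_double ?expf_card //.
  by apply: contraNneq a0 => c0; rewrite -c2 c0 expr0n.
have: a ^+ q.-1./2 ^+ 2 == 1.
  by rewrite -exprM mulnC expr_half_double ?expf_card.
rewrite sqrf_eq1 => /orP[/eqP ah|/eqP -> //].
(* A square root x of [a] in [K] satisfies x^q = x (x^2)^((q-1)/2) = x, so it lies in [F], and [a]
   would be a square. *)
pose P i : K := if i == 0%N then f a else 0.
have [x] := solve_monicpoly P (isT : (0 < 2)%N).
rewrite big_ord_recl big_ord1 /P /= mul0r addr0 expr0 mulr1 => x2.
have xq : x ^+ q = x.
  by rewrite -half_double exprS mulnC exprM x2 -rmorphXn ah rmorph1 mulr1.
have [c xc] := fixed_in_base _ xq; case: nsq; exists c.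
by apply/eqP/(fmorph_inj f); rewrite rmorphXn -xc.
Qed.

(** Integer signs may be compared inside [F], where 0, 1 and -1 stay distinct because 2 != 0. *)
Lemma legendre_eq_sign (a : F) (b : bool) :
  (legendre a == (-1) ^+ b) = (a ^+ q.-1./2 == (-1) ^+ b).
Proof.
rewrite -legendre_expr /legendre.
have neq1 : 1 != -1 :> F.
  by rewrite -subr_eq0 opprK (two_neq0 F idfun).
have neqN1 : -1 != 1 :> F by rewrite eq_sym.
have neq0 : 0 != -1 :> F by rewrite eq_sym oppr_eq0 oner_eq0.
have neq01 : 0 != 1 :> F by rewrite eq_sym oner_eq0.
by case: ifP => _; last case: ifP => _; case: b; rewrite ?rmorph0 ?rmorphN1 ?rmorph1
  ?expr0 ?expr1 ?eqxx ?(negPf neq1) ?(negPf neqN1) ?(negPf neq0) ?(negPf neq01).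
Qed.

(* (q - eta)/2 with eta = e1 e2 encoded by b: eta = (-1)^b. *)
Definition half_order (b : bool) : nat := if b then q.+1./2 else q.-1./2.

Lemma half_orderE b : half_order b = (q.-1./2 + b)%N.
Proof.
by rewrite /half_order; case: b; move: q_odd (finNzRing_gt1 F); move: q => n; lia.
Qed.

Lemma half_order_double b : (half_order b * 2)%N = if b then q.+1 else q.-1.
Proof.
by rewrite half_orderE; move: half_double; move: q => n; case: b; lia.
Qed.

(** * The classes in terms of the parameter y *)

Lemma frobenius_cases (u : F) (y : K) : y != 0 -> f u = y + y^-1 ->
  exists b : bool, y ^+ q = if b then y^-1 else y.
Proof.
move=> y0 fu; have yq0 : y ^+ q != 0 by rewrite expf_neq0.
case: (addfV_eq _ _ _ yq0 y0) => [|yq|yq]; last 2 first.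
- by exists false.
- by exists true.
by rewrite -exprVn -exprD_card -fu fixed_rmorph.
Qed.

(** Twice [half_order b] is q - 1 or q + 1, so the hypothesis on y^q says that y^(half_order b) has
    square 1. *)
Lemma half_order_sign (y : K) (b : bool) : y != 0 ->
  y ^+ q = (if b then y^-1 else y) -> exists c : bool, y ^+ half_order b = (-1) ^+ c.
Proof.
move=> y0 yq; have : y ^+ half_order b ^+ 2 == 1.
  have yqS : y ^+ (half_order b * 2) * y = y ^+ q * y ^+ (b * 2).
    rewrite -exprSr -exprD; congr (_ ^+ _).
    by rewrite half_orderE; move: half_double; move: q => n; case: b {yq}; lia.
  rewrite -exprM; apply/eqP/(mulIf y0); rewrite yqS yq.
  by case: b {yq yqS}; rewrite ?expr0 ?mulr1 ?mul1r // mul1n expr2 mulKf.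
rewrite sqrf_eq1 => /orP[] /eqP ->; first by exists false.
by exists true.
Qed.

Lemma frobenius_of_sign (y : K) (b c : bool) : y != 0 ->
  y ^+ half_order b = (-1) ^+ c -> y ^+ q = if b then y^-1 else y.
Proof.
move=> y0 ym; have ym2 : y ^+ (half_order b * 2) = 1 by rewrite exprM ym sqrr_sign.
have /eqP : y ^+ q * y ^+ (b * 2) = y.
  rewrite -[RHS]mul1r -ym2 -exprSr -exprD; congr (_ ^+ _).
  by rewrite half_orderE; move: half_double; move: q => n; case: b {ym ym2}; lia.
case: b {ym ym2} => /eqP; last by rewrite expr0 mulr1.
by move=> yy; apply: (mulIf (expf_neq0 2 y0)); rewrite yy expr2 mulKf.
Qed.

(** With s = (-1)^a and x = y + s, one has u + 2s = x^2 / y. Its (q-1)/2-th power is x^(q-1) /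
    y^((q-1)/2), where x^q = y^q + s. *)
Lemma shift_half_expr (u : F) (y : K) (a b c : bool) :
  y != 0 -> f u = y + y^-1 -> y ^+ 2 != 1 -> y ^+ half_order b = (-1) ^+ c ->
  f (u + (-1) ^+ a * 2) ^+ q.-1./2 = (-1) ^+ ((a && b) (+) c).
Proof.
move=> y0 fu y2 ym; set s : K := (-1) ^+ a; set x := y + s.
have s2 : s * s = 1 by rewrite -expr2 sqrr_sign.
have x0 : x != 0.
  by apply: contraNneq y2 => /eqP; rewrite addr_eq0 => /eqP ->; rewrite sqrrN sqrr_sign.
have -> : f (u + (-1) ^+ a * 2) = x ^+ 2 / y.
  rewrite rmorphD rmorphM rmorph_sign rmorph_nat fu -/s; apply: (mulIf y0).
  by rewrite divfK // mulrDl mulrDl mulVf // /x; ring: s2.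
have sq : s ^+ q = s by rewrite /s -exprM mulnC exprM -(signr_odd _ q) q_odd expr1.
have xq : x ^+ (2 * q.-1./2) * x = y ^+ q + s.
  by rewrite -exprSr mulnC half_double exprD_card sq.
rewrite expr_div_n -exprM; apply: (canLR (mulfK (expf_neq0 _ y0))).
apply: (mulIf x0); rewrite xq (frobenius_of_sign _ _ _ y0 ym).
(* If [b] is false, x^q = x. If [b] is true, x^q = 1/y + s = s x / y, and the factor s is the extra
   sign [a && b]. *)
move: ym; rewrite half_orderE exprD signr_addb; case: b => ym.
  rewrite expr1 in ym; rewrite andbT -ym -/s; apply: (mulIf y0).
  rewrite mulrDl mulVf //.
  have yh : y ^+ q.-1./2 * y * (y ^+ q.-1./2 * y) = 1 by rewrite -expr2 ym sqrr_sign.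
  by rewrite /x; ring: s2 yh.
rewrite expr0 mulr1 in ym; rewrite andbF ym expr0 mul1r -/s.
by rewrite -expr2 sqrr_sign mul1r.
Qed.

(** Writing e2 = (-1)^c and e1 = (-1)^(b+c) makes e1 e2 = (-1)^b, which selects the exponent. *)
Lemma Aset_param (u : F) (y : K) (b c : bool) :
  y != 0 -> f u = y + y^-1 ->
  (u \in Aset (2 : F) ((-1) ^+ (b (+) c)) ((-1) ^+ c)) =
  (y ^+ 2 != 1) && (y ^+ half_order b == (-1) ^+ c).
Proof.
move=> y0 fu; rewrite inE !legendre_eq_sign.
have fX (a d : bool) : ((u + (-1) ^+ a * 2) ^+ q.-1./2 == (-1) ^+ d) =
    (f (u + (-1) ^+ a * 2) ^+ q.-1./2 == (-1) ^+ d).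
  by rewrite -rmorphXn -(rmorph_sign f) (inj_eq (fmorph_inj f)).
have -> : u - 2 = u + (-1) ^+ true * 2 by rewrite expr1 mulN1r.
have -> : u + 2 = u + (-1) ^+ false * 2 by rewrite expr0 mul1r.
rewrite !fX; have [y2|y2] := eqVneq (y ^+ 2) 1; rewrite [~~ _]/= ?andFb ?andTb.
  (* Here y is 1 or -1, so u is 2 or -2 and one of the two Legendre symbols vanishes. *)
  move/eqP: y2; rewrite sqrf_eq1 => /orP[]/eqP y1; move: fu; rewrite y1.
    rewrite invr1 => fu; apply/negbTE/nandP; left.
    rewrite rmorphD fu rmorphM rmorph_sign rmorph_nat expr1 mulN1r subrr.
    by rewrite expr0n gtn_eqF ?half_gt0 // eq_sym signr_eq0.
  rewrite invrN invr1 => fu; apply/negbTE/nandP; right.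
  rewrite rmorphD fu rmorphM rmorph_sign rmorph_nat expr0 mul1r -opprD addNr.
  by rewrite expr0n gtn_eqF ?half_gt0 // eq_sym signr_eq0.
apply/andP/eqP => [[/eqP um /eqP up]|ym]; last first.
  by rewrite !(shift_half_expr _ _ _ _ _ y0 fu y2 ym).
(* Any [y] has some type (b', c'). The symbol at u + 2 gives c' = c, and then the one at u - 2 gives
   b' = b. *)
have [b' yq] := frobenius_cases _ _ y0 fu; have [c' ym] := half_order_sign _ _ y0 yq.
rewrite !(shift_half_expr _ _ _ _ _ y0 fu y2 ym) in um up.
move/(signr_field_inj _ f): um; move/(signr_field_inj _ f): up => /= <-.
by move/addIb => <-.
Qed.

(** * Images of the classes under D_k *)

(** The parameter y^k keeps the type [b], and its sign exponent kc has parity [c']. The last two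
    cases are y^k = 1 and y^k = -1; raising these to the power [half_order b] gives the side
    conditions. *)
Lemma dickson_class (u : F) (k : nat) (b c : bool) :
  u \in Aset (2 : F) ((-1) ^+ (b (+) c)) ((-1) ^+ c) ->
  let c' := odd k && c in
  [\/ dfun k u \in Aset (2 : F) ((-1) ^+ (b (+) c')) ((-1) ^+ c'),
      dfun k u = 2 /\ ~~ c' | dfun k u = -2 /\ odd (half_order b) = c'].
Proof.
have [y y0 fu] := addfV_root u.
rewrite (Aset_param _ _ _ _ y0 fu) => /andP[y2 /eqP ym] c'.
have yk0 : y ^+ k != 0 by rewrite expf_neq0.
have fk := rmorph_dfun F K f k u y y0 fu; rewrite exprVn in fk.
have ykm : y ^+ k ^+ half_order b = (-1) ^+ c'.
  by rewrite -exprM mulnC exprM ym -exprM mulnC -(signr_odd _ (k * c)%N) oddM oddb.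
have [yk2|yk2] := eqVneq (y ^+ k ^+ 2) 1; last first.
  by constructor 1; rewrite (Aset_param _ _ _ _ yk0 fk) yk2 ykm eqxx.
move/eqP: yk2; rewrite sqrf_eq1 => /orP[]/eqP yk1; rewrite yk1 in fk ykm.
  constructor 2; split; first by apply: (fmorph_inj f); rewrite fk invr1 rmorph_nat.
  by rewrite expr1n -(expr0 (-1)) in ykm; rewrite -(signr_field_inj _ f false c' ykm).
constructor 3; split; first by apply: (fmorph_inj f);
  rewrite fk invrN invr1 rmorphN rmorph_nat -opprD.
by apply: (signr_field_inj _ f); rewrite signr_odd.
Qed.

Lemma dfun_pm2 (u : F) (y : K) (k : nat) :
  y != 0 -> f u = y + y^-1 -> y ^+ k ^+ 2 = 1 -> dfun k u \in [set 2; -2].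
Proof.
move=> y0 fu /eqP; rewrite sqrf_eq1 !inE => yk.
have fk := rmorph_dfun F K f k u y y0 fu; rewrite exprVn in fk.
case/orP: yk fk => /eqP ->; rewrite -!(inj_eq (fmorph_inj f)) => ->.
  by rewrite invr1 rmorph_nat eqxx.
by rewrite invrN invr1 rmorphN rmorph_nat -opprD eqxx orbT.
Qed.

(** If [y] has type [b], then y^k is 1 or -1. Otherwise, unless u is already 2 or -2, it lies in a
    class of type [~~ b], a type that D_k preserves. *)
Lemma dickson_dvd (u : F) (k : nat) (b : bool) : (half_order b %| k)%N ->
  dfun k u \in [set 2; -2] \/
  exists c : bool, let c' := odd k && c in
    dfun k u \in Aset (2 : F) ((-1) ^+ (~~ b (+) c')) ((-1) ^+ c').
Proof.
move=> m_k; have [y y0 fu] := addfV_root u.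
have [y2|y2] := eqVneq (y ^+ 2) 1.
  by left; apply: (dfun_pm2 _ _ _ y0 fu); rewrite -exprM mulnC exprM y2 expr1n.
have [b' yq] := frobenius_cases _ _ y0 fu; have [c ym] := half_order_sign _ _ y0 yq.
have [bb|bb] := eqVneq b' b.
  left; apply: (dfun_pm2 _ _ _ y0 fu).
  rewrite -(divnK m_k) mulnC exprM -bb ym.
  by rewrite -[X in X ^+ 2]exprM sqrr_sign.
have uA : u \in Aset (2 : F) ((-1) ^+ (b' (+) c)) ((-1) ^+ c).
  by rewrite (Aset_param _ _ _ _ y0 fu) y2 ym eqxx.
have -> : ~~ b = b' by case: b b' bb {m_k yq ym uA} => [] [].
have := dickson_class u k b' c uA.
case=> [uk|[uk _]|[uk _]]; first by right; exists c.
  by left; rewrite uk !inE eqxx.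
by left; rewrite uk !inE eqxx orbT.
Qed.

(** * The permutation criterion *)

(** Frobenius fixes or exchanges y and 1/y, hence fixes their sum. *)
Lemma half_order_base (y : K) (b c : bool) : y != 0 ->
  y ^+ half_order b = (-1) ^+ c -> exists u : F, f u = y + y^-1.
Proof.
move=> y0 ym; have yq := frobenius_of_sign _ _ _ y0 ym.
have : (y + y^-1) ^+ q = y + y^-1.
  by rewrite exprD_card exprVn yq; case: b {ym yq} => //; rewrite invrK addrC.
by case/fixed_in_base=> u ->; exists u.
Qed.

(** Since q = 0 in [K], twice this number is 1 or -1. Hence every prime dividing [half_order b] has
    a nontrivial root of unity in [K]. *)
Lemma half_order_neq0 (b : bool) : (half_order b)%:R != 0 :> K.
Proof.
have q0 : (q.-1./2 * 2)%:R + 1 = 0 :> K.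
  by rewrite -mulrSr half_double -(rmorph_nat f) natf_card rmorph0.
apply/eqP => m0; have : (half_order b * 2)%:R = 0 :> K by rewrite natrM m0 mul0r.
rewrite half_orderE mulnDl natrD; set a := (_ * 2)%:R in q0 * => m2.
have /eqP[] := oner_neq0 K; case: b {m0} m2; rewrite ?mul1n ?mul0n => m2.
  by have -> : 1 = a + 2 - (a + 1) :> K; [ring | rewrite m2 q0 subrr].
by have -> : 1 = a + 1 - (a + 0) :> K; [ring | rewrite m2 q0 subrr].
Qed.

(** The number [half_order b * c.+1] is d^{e1,e2}: when [c] is true the power of [y] is -1, and the
    exponent must be doubled to reach 1. As [A] is finite, an injective self-map is a
    permutation. *)
Lemma coprime_permutes (k : nat) (b c : bool)
    (A := Aset (2 : F) ((-1) ^+ (b (+) c)) ((-1) ^+ c)) :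
  (0 < k)%N -> coprime k (half_order b * c.+1) ->
  (dfun k @: A \subset A) /\ {in A &, injective (dfun k)}.
Proof.
move=> k0 kn.
have class_eq1 (y : K) : y ^+ half_order b = (-1) ^+ c ->
    y ^+ (half_order b * c.+1) = 1.
  by move=> ym; rewrite exprM ym; case: c {A kn ym}; rewrite ?sqrr_sign ?expr1.
(* For [c] true the exponent is even, so [k] is odd and y -> y^k keeps the sign. *)
have kc : odd k && c = c.
  move: kn; rewrite coprimeMr; case: c {A class_eq1}; last by rewrite andbF.
  by rewrite coprimen2 => /andP[_ ->].
split.
  apply/subsetP => _ /imsetP[u uA ->].
  have [y y0 fu] := addfV_root u.
  move: uA; rewrite (Aset_param _ _ _ _ y0 fu) => /andP[y2 /eqP ym].
  have yk0 : y ^+ k != 0 by rewrite expf_neq0.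
  have fk := rmorph_dfun F K f k u y y0 fu; rewrite exprVn in fk.
  rewrite (Aset_param _ _ _ _ yk0 fk); apply/andP; split.
    apply: contraNneq y2 => yk2; apply/eqP/(coprime_expr_eq1 _ _ _ _ k0 kn).
      by rewrite -exprM mulnC exprM.
    by rewrite -exprM mulnC exprM class_eq1 // expr1n.
  by rewrite -exprM mulnC exprM ym -exprM mulnC -(signr_odd _ (k * c)%N) oddM oddb kc.
move=> u v; have [y y0 fu] := addfV_root u; have [z z0 fv] := addfV_root v.
rewrite (Aset_param _ _ _ _ y0 fu) (Aset_param _ _ _ _ z0 fv).
move=> /andP[_ /eqP ym] /andP[_ /eqP zm] /(congr1 f).
rewrite (rmorph_dfun F K f k u y y0 fu) (rmorph_dfun F K f k v z z0 fv) !exprVn.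
(* Equal images give y^k = z^k or y^k = z^-k, so y/z or yz is sent to 1 by two coprime exponents. *)
case/addfV_eq; rewrite ?expf_neq0 // => yz; apply: (fmorph_inj f); rewrite fu fv.
  suff /divr1_eq -> : y / z = 1 by [].
  apply: (coprime_expr_eq1 _ _ _ _ k0 kn); rewrite expr_div_n.
    by rewrite yz divff ?expf_neq0.
  by rewrite !class_eq1 // divff ?oner_neq0.
have : y / z^-1 = 1.
  apply: (coprime_expr_eq1 _ _ _ _ k0 kn); rewrite invrK exprMn.
    by rewrite yz mulVf ?expf_neq0.
  by rewrite !class_eq1 // mulr1.
by move/divr1_eq ->; rewrite invrK addrC.
Qed.

Lemma pm2_notin_Aset (x : F) (b c : bool) :
  x \in [set 2; -2] -> x \notin Aset (2 : F) ((-1) ^+ (b (+) c)) ((-1) ^+ c).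
Proof.
move=> x2; have [s ->] : exists s : bool, x = (-1) ^+ s * 2.
  by case/set2P: x2 => ->; [exists false; rewrite mul1r | exists true; rewrite mulN1r].
have fs : f ((-1) ^+ s * 2) = (-1) ^+ s + ((-1) ^+ s)^-1.
  by rewrite rmorphM rmorph_sign rmorph_nat invr_sign mulr_natr mulr2n.
have s0 : (-1) ^+ s != 0 :> K by rewrite signr_eq0.
by rewrite (Aset_param _ _ _ _ s0 fs) sqrr_sign eqxx.
Qed.

Lemma permutes_coprime (k : nat) (b c : bool)
    (A := Aset (2 : F) ((-1) ^+ (b (+) c)) ((-1) ^+ c)) :
  A != set0 -> dfun k @: A \subset A -> {in A &, injective (dfun k)} ->
  (0 < k)%N -> coprime k (half_order b * c.+1).
Proof.
case/set0Pn => u uA DA Dinj k0.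
have DuA : dfun k u \in A by apply: (subsetP DA); apply: imset_f.
(* For even [k] the image has e2 = 1 or is 2 or -2, so it leaves a class with e2 = -1. *)
have kc : c -> odd k.
  move=> c1; apply: contraT => /negPf k2; have := dickson_class u k b c uA.
  rewrite k2 /= => -[DuA' |[Du _]|[Du _]].
  - by move: DuA DuA'; rewrite !inE c1 => /andP[_ /eqP ->] /andP[_].
  - by have := pm2_notin_Aset (dfun k u) b c; rewrite DuA Du set21 => /(_ isT).
  - by have := pm2_notin_Aset (dfun k u) b c; rewrite DuA Du set22 => /(_ isT).
apply: contraT => ncop.
have [p p_pr] : exists2 p, prime p & (p %| gcdn k (half_order b * c.+1))%N.
  exists (pdiv (gcdn k (half_order b * c.+1))); last exact: pdiv_dvd.
  by rewrite pdiv_prime // ltn_neqAle eq_sym ncop gcdn_gt0 k0.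
rewrite dvdn_gcd Euclid_dvdM // => /andP[p_k p_m].
(* Otherwise p divides [c.+1], which forces p = 2 and [c] true, whereas [k] is then odd. *)
have {}p_m : (p %| half_order b)%N.
  case/orP: p_m => // p_c; move: (dvdn_leq (ltn0Sn c) p_c) (prime_gt1 p_pr) p_k.
  case: c kc {A uA DA Dinj DuA p_c ncop} => [/(_ isT) k_odd|_]; last by lia.
  move=> p2 p1 /dvdn_odd/(_ k_odd); by lia.
have [z zp z1] := unity_root_pdiv p _ p_pr (half_order_neq0 b) p_m.
have zk : z ^+ k = 1 := expr_dvd zp p_k.
have zm : z ^+ half_order b = 1 := expr_dvd zp p_m.
have z0 : z != 0.
  by apply/eqP => z0; move/eqP: zk; rewrite z0 expr0n gtn_eqF // eq_sym oner_eq0.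
have [y y0 fu] := addfV_root u.
have := uA; rewrite (Aset_param _ _ _ _ y0 fu) => /andP[y2 /eqP ym].
have yk2 : y ^+ k ^+ 2 != 1.
  apply/eqP => yk2; have := pm2_notin_Aset (dfun k u) b c.
  by rewrite (dfun_pm2 _ _ _ y0 fu yk2) DuA => /(_ isT).
(* Multiplying by [z] changes neither the [half_order b]-th nor the k-th power, so y z yields an
   element of [A] with the same image. *)
have w0 : y * z != 0 by rewrite mulf_neq0.
have wm : (y * z) ^+ half_order b = (-1) ^+ c by rewrite exprMn zm mulr1.
have wk : (y * z) ^+ k = y ^+ k by rewrite exprMn zk mulr1.
have [v fv] := half_order_base _ _ _ w0 wm.
have vA : v \in A.
  rewrite (Aset_param _ _ _ _ w0 fv) wm eqxx andbT.
  by apply: contraNneq yk2 => w2; rewrite -wk -exprM mulnC exprM w2 expr1n.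
have uv : u = v.
  apply: Dinj => //; apply: (fmorph_inj f).
  by rewrite (rmorph_dfun F K f k u y y0 fu) (rmorph_dfun F K f k v _ w0 fv) !exprVn wk.
(* Either y = y z, so z = 1, or y = 1/(y z), so y^2 = 1/z and y^(2k) = 1; both are excluded. *)
move: fv; rewrite -uv fu => /addfV_eq - /(_ y0 w0) [yw|yw].
  by case/eqP: z1; apply: (mulfI y0); rewrite -yw mulr1.
case/eqP: yk2; rewrite -exprM mulnC exprM.
have -> : y ^+ 2 = z^-1.
  by rewrite expr2 [X in _ * X]yw invfM mulrA divff // mul1r.
by rewrite exprVn zk invr1.
Qed.

End ClosedExtension.

(** * Translation into the six stated parts *)

Theorem theorem1p1 (F : finFieldType) (k : nat) :
  odd #|F| -> (0 < k)%N ->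
  let q := #|F| in
  let e : F := (epsq F)%:~R in
  let D := dfun k in
  let A := Aset (2 : F) in
  [/\ D 2 = 2 /\ D (-2) = (-1) ^+ k * 2,
      (* (i) *)
      D @: A 1 1 \subset A 1 1 :|: [set 2; - 2 * e] /\
      D @: A (-1) 1 \subset A (-1) 1 :|: [set 2; 2 * e],
      (* (ii) *)
      odd k ->
        D @: A (epsq F) (-1) \subset A (epsq F) (-1) :|: [set - 2] /\
        D @: A (- epsq F) (-1) \subset A (- epsq F) (-1),
      (* (iii) *)
      ~~ odd k ->
        D @: A (-1) (-1) \subset A 1 1 :|: [set 2; - 2 * e] /\
        D @: A 1 (-1) \subset A (-1) 1 :|: [set 2; 2 * e]
    & [/\
      (* (iv) *)
      (q.-1./2 %| k)%N ->
        D @: [set: F] \subset A 1 (-1) :|: A (-1) 1 :|: [set 2; - 2] /\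
        (~~ odd k -> D @: [set: F] \subset A (-1) 1 :|: [set 2; - 2]),
      (* (v) *)
      (q.+1./2 %| k)%N ->
        D @: [set: F] \subset A 1 1 :|: A (-1) (-1) :|: [set 2; - 2] /\
        (~~ odd k -> D @: [set: F] \subset A 1 1 :|: [set 2; - 2])
    & (* (vi) *)
      forall e1 e2 : int, (e1 = 1 \/ e1 = -1) -> (e2 = 1 \/ e2 = -1) ->
        A e1 e2 != set0 ->
        ((D @: A e1 e2 \subset A e1 e2) /\ {in A e1 e2 &, injective D}
          <-> coprime k (dsign q e1 e2))]].

Proof.
move=> q_odd k0 q e D A.
have [K [f _]] := countable_algebraic_closure F.
pose S (b c : bool) : {set F} := A ((-1) ^+ (b (+) c)) ((-1) ^+ c).
have A11 : A 1 1 = S false false by [].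
have AN1 : A (-1) 1 = S true false by [].
have A1N : A 1 (-1) = S true true by [].
have ANN : A (-1) (-1) = S false true by [].
(* The value -2 can occur only if [half_order F b], of parity o + b, has parity [c']; this is how
   [epsq F] = (-1)^o enters. *)
pose o := odd q.-1./2.
have eps : epsq F = (-1) ^+ o by rewrite /epsq -signr_odd.
have eE : e = (-1) ^+ o by rewrite /e eps rmorph_sign.
have oddm b : odd (half_order F b) = o (+) b.
  by rewrite half_orderE // oddD; case: b.
have class := dickson_class F K f q_odd.
have [epsA NepsA] : A (epsq F) (-1) = S (~~ o) true /\ A (- epsq F) (-1) = S o true.
  by rewrite eps /S; case: (o); rewrite /= ?expr0 ?expr1 ?opprK.
(* Taking [b] false gives (iv), and [b] true gives (v). *)
have half b : (half_order F b %| k)%N -> D @: [set: F] \subset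
      S (~~ b) true :|: S (~~ b) false :|: [set 2; -2] /\
    (~~ odd k -> D @: [set: F] \subset S (~~ b) false :|: [set 2; -2]).
  move=> m_k; split=> [|/negPf k2]; apply/subsetP => _ /imsetP[u _ ->].
    have [Du|[c Du]] := dickson_dvd F K f q_odd u k b m_k; rewrite in_setU.
      by rewrite Du orbT.
    by apply/orP; left; rewrite in_setU; apply/orP; case: (_ && _) Du; [left | right].
  have [Du|[c]] := dickson_dvd F K f q_odd u k b m_k; rewrite in_setU.
    by rewrite Du orbT.
  by rewrite k2 => Du; apply/orP; left.
split.
- rewrite /D /dfun; split.
    have := horner_dickson F 1 k (oner_neq0 _).
    by rewrite invr1 expr1n.
  have := horner_dickson F (-1) k; rewrite oppr_eq0 oner_neq0 => /(_ isT).
  by rewrite invrN invr1 -opprD mulr_natr mulr2n.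
- rewrite A11 AN1; split; apply/subsetP => _ /imsetP[u uA ->].
    have := class u k false false uA; rewrite andbF oddm.
    case=> [Du|[Du _]|[Du]]; rewrite in_setU; first by apply/orP; left.
      by rewrite /D Du set21 orbT.
    by rewrite eE addbF => ->; rewrite expr0 mulr1 /D Du set22 orbT.
  have := class u k true false uA; rewrite andbF oddm.
  case=> [Du|[Du _]|[Du]]; rewrite in_setU; first by apply/orP; left.
    by rewrite /D Du set21 orbT.
  by rewrite eE addbT => /negbFE ->; rewrite expr1 mulrN1 /D Du set22 orbT.
- move=> k_odd; rewrite epsA NepsA; split; apply/subsetP => _ /imsetP[u uA ->].
    have := class u k _ true uA; rewrite k_odd oddm.
    case=> [Du|[_ //]|[Du _]]; rewrite in_setU; first by apply/orP; left.
    by rewrite /D Du set11 orbT.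
  (* Here [c'] is true, which rules out 2, and the half order is even, which rules out -2. *)
  have := class u k _ true uA; rewrite k_odd oddm addbb.
  by case=> [//|[_ //]|[_ //]].
- move=> /negPf k2; rewrite ANN A1N A11 AN1.
  split; apply/subsetP => _ /imsetP[u uA ->].
    have := class u k false true uA; rewrite k2 oddm.
    case=> [Du|[Du _]|[Du]]; rewrite in_setU; first by apply/orP; left.
      by rewrite /D Du set21 orbT.
    by rewrite eE addbF => ->; rewrite expr0 mulr1 /D Du set22 orbT.
  have := class u k true true uA; rewrite k2 oddm.
  case=> [Du|[Du _]|[Du]]; rewrite in_setU; first by apply/orP; left.
    by rewrite /D Du set21 orbT.
  by rewrite eE addbT => /negbFE ->; rewrite expr1 mulrN1 /D Du set22 orbT.
split; first by rewrite A1N AN1; exact: (half false).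
  by rewrite A11 ANN (setUC (S false false)); exact: (half true).
have vi b c : S b c != set0 ->
    dsign q ((-1) ^+ (b (+) c)) ((-1) ^+ c) = (half_order F b * c.+1)%N ->
    (D @: S b c \subset S b c /\ {in S b c &, injective D}
      <-> coprime k (dsign q ((-1) ^+ (b (+) c)) ((-1) ^+ c))).
  move=> S0 ->; split=> [[DS Dinj]|].
    exact: (permutes_coprime F K f q_odd).
  exact: (coprime_permutes F K f q_odd).
move=> e1 e2 [] -> [] ->.
- by move/(vi false false); apply; rewrite muln1.
- by move/(vi true true); apply; rewrite half_order_double.
- by move/(vi true false); apply; rewrite muln1.
- by move/(vi false true); apply; rewrite half_order_double.
Qed.
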